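(* Let $S$ be a semitopological semigroup, let $T$ be a subsemigroup of $S$, and let $\overline{T}$ be the closure of $T$ in $S$. If $T$ admits a tight ideal series, then any regular element of $\overline{T}$ (that is, any $x\in\overline{T}$ for which there exists $y\in\overline{T}$ with $xyx=x$), in particular any idempotent of $\overline{T}$, must already be in $T$.
   Context: All topological spaces are assumed Hausdorff. A semitopological semigroup is a semigroup equipped with a Hausdorff topology for which all left translations $x\mapsto sx$ and all right translations $x\mapsto xs$ are continuous; the closure of a subsemigroup is then a subsemigroup. An ideal of a semigroup $T$ is a nonempty subset $I\subseteq T$ with $TI\cup IT\subseteq I$. A subset $D$ of a semigroup $T$ is $\omega$-unstable if $D$ is infinite and for any $a\in D$ and any infinite subset $B\subseteq D$ we have $aB\cup Ba\not\subseteq D$. An ideal series for a semigroup $T$ is a chain of ideals $I_0\subseteq I_1\subseteq\cdots\subseteq I_m=T$ of $T$; it is tight if $I_0$ is a finite set and $I_k\setminus I_{k-1}$ is an $\omega$-unstable subset of $T$ for each $k=1,\ldots,m$. *)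

(* Defs.v *)
From HB Require Import structures.
From mathcomp Require Import all_boot.
From mathcomp Require Import all_classical topology.

Set Implicit Arguments.
Unset Strict Implicit.
Unset Printing Implicit Defensive.

Local Open Scope classical_set_scope.
Local Open Scope group_scope.

HB.mixin Record isSemitopologicalSemigroup S
    & Topological S & Semigroup S := {
  semitop_hausdorff : hausdorff_space S ;
  continuous_mulgl : forall s : S, continuous (fun x : S => s * x) ;
  continuous_mulgr : forall s : S, continuous (fun x : S => x * s) }.

#[short(type="semitopologicalSemigroupType")]
HB.structure Definition SemitopologicalSemigroup :=
  {S of isSemitopologicalSemigroup S & Topological S & Semigroup S}.

Section Definitions.
Context {S : semigroupType}.
Implicit Types (T I D A B : set S) (x : S).

Definition prodset A B : set S := [set a * b | a in A & b in B].

(* The empty set is allowed: a subsemigroup with an ideal is nonempty anyway. *)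
Definition subsemigroup T := prodset T T `<=` T.

Definition ideal T I :=
  [/\ I !=set0, I `<=` T & prodset T I `|` prodset I T `<=` I].

Definition omega_unstable T D :=
  [/\ D `<=` T, infinite_set D &
      forall a B, D a -> B `<=` D -> infinite_set B ->
        ~ (prodset [set a] B `|` prodset B [set a] `<=` D)].

(* Only the values I 0, ..., I m matter. *)
Definition ideal_series T m (I : nat -> set S) :=
  [/\ forall k, k <= m -> ideal T (I k),
      forall k, k < m -> I k `<=` I k.+1 &
      I m = T].

Definition tight_ideal_series T m (I : nat -> set S) :=
  [/\ ideal_series T m I,
      finite_set (I 0) &
      forall k, 1 <= k <= m -> omega_unstable T (I k `\` I k.-1)].

Definition regular_in T x := T x /\ exists2 y, T y & x * y * x = x.

Definition idempotent_in T x := T x /\ x * x = x.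

End Definitions.

(* Main.v *)
(** If [I] and [J] are consecutive ideals of the series and [D] is their difference,
    then by instability every idempotent [e] in [closure I] but not in [closure J]
    lies in [D], and the local set of all [d] in [D] with [e d = d = d e] is finite.
    For a regular [x = x y x] in [closure I] but not in [closure J], put
    [e = x y].  Finiteness of the local set at [e] lets one
    first replace [y] by some [t] in [T] with [x t = e], and then approximate
    [x] by some [v] in [T] with [e v t = e]; hence [x = e x = e v (t x)],
    a product of elements of [T]. *)
Require Import Defs.
From HB Require Import structures.
From mathcomp Require Import all_boot.
From mathcomp Require Import all_classical topology.

Local Open Scope classical_set_scope.
Local Open Scope group_scope.

Section SemitopologicalSemigroup.
Context {S : semitopologicalSemigroupType}.
Implicit Types (A B C U F : set S) (s x y : S).

Lemma nbhs_mull s x U : nbhs (s * x) U -> nbhs x [set y | U (s * y)].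
Proof. exact: continuous_mulgl. Qed.

Lemma nbhs_mulr s x U : nbhs (x * s) U -> nbhs x [set y | U (y * s)].
Proof. exact: continuous_mulgr. Qed.

(** Multiplication is only separately continuous, so one factor moves at a time: first [y] is
    approximated with [a] in [A] fixed, then [x]. The second passage lands in the closure of
    [closure C]. *)
Lemma prodset_closure A B C :
  prodset A B `<=` C -> prodset (closure A) (closure B) `<=` closure C.
Proof.
move=> ABC _ [x clx [y cly <-]].
have clC a : A a -> closure C (a * y).
  move=> Aa U /nbhs_mull /cly[b [Bb Ub]].
  by exists (a * b); split=> //; apply: ABC; exists a => //; exists b.
apply: closed_closure => U /nbhs_mulr /clx[a [Aa Ua]].
by exists (a * y); split=> //; apply: clC.
Qed.

Lemma finite_set_closed F : finite_set F -> closed F.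
Proof.
move: F; apply/accessible_finite_set_closed/hausdorff_accessible.
exact: semitop_hausdorff.
Qed.

Lemma nbhs_setC_finite F x : finite_set F -> ~ F x -> nbhs x (~` F).
Proof.
move=> finF nFx; apply: open_nbhs_nbhs; split=> //.
by apply: closed_openC; apply: finite_set_closed.
Qed.

End SemitopologicalSemigroup.

Lemma omega_unstable_finite (S : semigroupType) (T D B : set S) (a : S) :
  omega_unstable T D -> D a -> B `<=` D ->
  (forall b, B b -> D (a * b) /\ D (b * a)) -> finite_set B.
Proof.
move=> [_ _ unst] Da BD aBa; apply: contrapT => infB.
apply: (unst a B Da BD infB) => _ [] [c cB [d dB <-]].
  by rewrite cB; case: (aBa d dB).
by rewrite dB; case: (aBa c cB).
Qed.

Section IdealStep.
Context {S : semitopologicalSemigroupType} (T I J : set S).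
Hypothesis subT : subsemigroup T.
Hypotheses (idI : ideal T I) (idJ : ideal T J).
Hypothesis unst : omega_unstable T (I `\` J).

Let IT : I `<=` T. Proof. by case: idI. Qed.

Let mulT a b : T a -> T b -> T (a * b).
Proof. by move=> Ta Tb; apply: subT; exists a => //; exists b. Qed.

Let mulIr a b : T a -> I b -> I (a * b).
Proof.
by move=> Ta Ib; case: idI => _ _; apply; left; exists a => //; exists b.
Qed.

Let mulIl a b : I a -> T b -> I (a * b).
Proof.
by move=> Ia Tb; case: idI => _ _; apply; right; exists a => //; exists b.
Qed.

Let clIl a b : closure I a -> closure T b -> closure I (a * b).
Proof.
move=> Ia Tb; apply: (@prodset_closure _ I T).
  by move=> _ [c Ic [d Td <-]]; apply: mulIl.
by exists a => //; exists b.
Qed.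

Let clIr a b : closure T a -> closure I b -> closure I (a * b).
Proof.
move=> Ta Ib; apply: (@prodset_closure _ T I).
  by move=> _ [c Tc [d Id <-]]; apply: mulIr.
by exists a => //; exists b.
Qed.

Let clJl a b : closure J a -> closure T b -> closure J (a * b).
Proof.
move=> Ja Tb; apply: (@prodset_closure _ J T).
  by case: idJ => _ _; rewrite subUset => -[].
by exists a => //; exists b.
Qed.

Let clJr a b : closure T a -> closure J b -> closure J (a * b).
Proof.
move=> Ta Jb; apply: (@prodset_closure _ T J).
  by case: idJ => _ _; rewrite subUset => -[].
by exists a => //; exists b.
Qed.

(** Unlike the complement of [J], this set is open, so membership survives small perturbations; a
    point of [I] in it lies in [I \ J]. *)
Let U := ~` closure J.

Let nbhsU x : U x -> nbhs x U.
Proof.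
move=> Ux; apply: open_nbhs_nbhs; split=> //.
by apply: closed_openC; apply: closed_closure.
Qed.

Let DU x : I x -> U x -> (I `\` J) x.
Proof. by move=> Ix Ux; split=> // /subset_closure. Qed.

Lemma idempotent_step e :
  closure I e -> ~ closure J e -> e * e = e -> (I `\` J) e.
Proof.
move=> Ie Ue ee; apply: contrapT => nDe.
have Uee : nbhs (e * e) U by rewrite ee; apply: nbhsU.
(* Since [e * e = e] is in [U], a point [b] of [I] close to [e] has both [b * e] and [e * b] in
   [U]. *)
have [b [Ib [Ub [Ube Ueb]]]] := Ie _
  (filterI (nbhsU _ Ue) (filterI (nbhs_mulr _ _ _ Uee) (nbhs_mull _ _ _ Uee))).
pose B := [set v | (I `\` J) v /\ (U (b * v) /\ U (v * b))].
have finB : finite_set B.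
  apply: (omega_unstable_finite _ T _ _ b unst) (DU _ Ib Ub) _ _.
    by move=> v [].
  move=> v [[Iv _] [Ubv Uvb]].
  by split; apply: DU => //; apply: mulIl => //; apply: IT.
have nBe : ~ B e by move=> [].
(* As [B] is finite and misses [e], some [v] in [I] close to [e] avoids [B]; but closeness to [e]
   also forces [v] into [B]. *)
have [v [Iv [Uv [nBv Hv]]]] := Ie _ (filterI (nbhsU _ Ue)
  (filterI (nbhs_setC_finite _ _ finB nBe)
    (filterI (nbhs_mull _ _ _ (nbhsU _ Ube)) (nbhs_mulr _ _ _ (nbhsU _ Ueb))))).
by apply: nBv; split=> //; apply: DU.
Qed.

Lemma regular_step x y :
  closure I x -> ~ closure J x -> closure T y -> x * y * x = x -> T x.
Proof.
move=> Ix Ux Ty xyx; have Tx := closureS IT Ix.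
have [e xy] : exists e, x * y = e by exists (x * y).
have ex : e * x = x by rewrite -xy.
have ee : e * e = e by rewrite -{2}xy mulgA ex.
have Ue : U e by move=> Je; apply: Ux; rewrite -ex; apply: clJl.
have De : (I `\` J) e by apply: idempotent_step => //; rewrite -xy; apply: clIl.
have Te : T e by apply: IT; case: De.
pose F := [set d | (I `\` J) d /\ (e * d = d /\ d * e = d)].
have finF : finite_set F.
  apply: (omega_unstable_finite _ T _ _ e unst) => //; first by move=> d [].
  by move=> d [Dd [-> ->]].
(* A neighbourhood of [e] that meets the finite set [F] at most in [e]: a product shown to lie in
   both equals [e] exactly. *)
pose W := U `&` ~` (F `\ e).
have nbhsW : nbhs e W.
  apply: filterI; first exact: nbhsU.
  by apply: nbhs_setC_finite; [exact: finite_setD | case=> _; apply].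
have FT v t : I v -> T t -> t * e = t -> U (e * v * t) -> F (e * v * t).
  move=> Iv Tt te Uevt; split; first by apply: DU => //; apply: mulIl => //; apply: mulIr.
  by split; [rewrite !mulgA ee | rewrite -mulgA te].
have WF d : W d -> F d -> d = e.
  by move=> [_ nFd] Fd; apply: contrapT => de; apply: nFd.
have [t Tt [te xt]] : exists2 t, T t & t * e = t /\ x * t = e.
  have We : nbhs (x * (y * e)) W by rewrite mulgA xy ee.
  have [s [Ts Ws]] := Ty _ (nbhs_mulr _ _ _ (nbhs_mull _ _ _ We)).
  (* The factor [e] on the right secures [t * e = t], which [FT] requires. *)
  exists (s * e); first exact: mulT.
  have see : s * e * e = s * e by rewrite -mulgA ee.
  (* If [x * t] were outside [F], then replacing [x] by a nearby [v] in [I] would keep [e * v * t]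
     in [U] and outside [F], against [FT]. *)
  split=> //; apply: WF => //; apply: contrapT => nF.
  have Uxs : nbhs (e * x * (s * e)) (U `&` ~` F).
    rewrite ex; apply: filterI; first by apply: nbhsU; case: Ws.
    exact: nbhs_setC_finite.
  rewrite -mulgA in Uxs.
  have [v [Iv]] := Ix _ (nbhs_mulr _ _ _ (nbhs_mull _ _ _ Uxs)).
  rewrite /= mulgA => -[Uv nFv].
  by apply: nFv; apply: FT => //; apply: mulT.
(* From [x * t = e], the element [t * x] is idempotent, and [x = x * (t * x)] keeps it out of
   [closure J]. *)
have Ttx : T (t * x).
  have cTt := subset_closure Tt.
  suff [/IT] : (I `\` J) (t * x) by [].
  apply: idempotent_step; first exact: clIr.
    by move=> Jtx; apply: Ux; rewrite -ex -xt -mulgA; apply: clJr.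
  by rewrite -mulgA (mulgA x) xt ex.
have We : nbhs (e * (x * t)) W by rewrite xt ee.
have [v [Iv]] := Ix _ (nbhs_mulr _ _ _ (nbhs_mull _ _ _ We)).
rewrite /= mulgA => Wv.
have evt : e * v * t = e by apply: WF => //; apply: FT => //; case: Wv.
rewrite -ex -evt -mulgA; apply: mulT => //.
by apply: IT; apply: mulIr.
Qed.

End IdealStep.

Theorem proposition9 (S : semitopologicalSemigroupType) (T : set S)
  (subT : subsemigroup T)
  (tightT : exists (m : nat) (I : nat -> set S), tight_ideal_series T m I) :
  (forall x : S, regular_in (closure T) x -> T x) /\
  (forall e : S, idempotent_in (closure T) e -> T e).
Proof.
have regT x : regular_in (closure T) x -> T x.
  case: tightT => m [I [[idI _ Im] finI0 unst]] [Tx [y Ty xyx]].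
  (* Descent along the series: [regular_step] applies at the first level whose closure contains [x],
     unless this is level 0, where [I 0] is finite and hence closed. *)
  suff H k : k <= m -> closure (I k) x -> T x by apply: (H m) => //; rewrite Im.
  elim: k => [_|k IHk km].
    rewrite -(closure_id (I 0)).1; last exact: finite_set_closed.
    by case: (idI 0 (leq0n m)) => _ + _; apply.
  move=> Ix; have [Jx|nJx] := pselect (closure (I k) x).
    by apply: IHk => //; apply: ltnW.
  apply: (regular_step T (I k.+1) (I k) subT _ _ _ x y) => //.
  - exact: idI.
  - by apply: idI; apply: ltnW.
  - exact: (unst k.+1).
split=> // e [Te ee]; apply: regT; split=> //.
by exists e; rewrite ?ee.
Qed.
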